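(* Let $d,n\ge1$, $k\ge0$, and let $\Sigma\in\mathbb{R}^{d\times d}$ be positive definite. Let $x^{(1)},\dots,x^{(n+1)}$ be i.i.d. $\mathcal{N}(0,\Sigma)$, $w_\star\sim\mathcal{N}(0,\Sigma^{-1})$ independent, and $y^{(i)}=\langle x^{(i)},w_\star\rangle$ for $i\le n$. Let $$Z_0=\begin{bmatrix} x^{(1)} & \cdots & x^{(n)} & x^{(n+1)}\\ y^{(1)} & \cdots & y^{(n)} & 0\end{bmatrix},\qquad M=\begin{bmatrix} I_n & 0\\ 0& 0\end{bmatrix}\in\mathbb{R}^{(n+1)\times(n+1)}.$$ For $A=\{A_i\}_{i=0}^k$ with each $A_i\in\mathbb{R}^{d\times d}$ symmetric, set $P_i=\begin{bmatrix}0_{d\times d}&0\\0&1\end{bmatrix}$, $Q_i=\begin{bmatrix}A_i&0\\0&0\end{bmatrix}$, $Z_{i+1}=Z_i+\frac1nP_iZ_iM(Z_i^\top Q_iZ_i)$ for $i=0,\dots,k$, and $$f(A)=\mathbb{E}\Big[\big([Z_{k+1}]_{d+1,n+1}+w_\star^\top x^{(n+1)}\big)^2\Big].$$ Let $\mathcal{S}$ be the set of $A=\{A_i\}_{i=0}^k$ such that for every $i$ there is a scalar $a_i\in\mathbb{R}$ with $A_i=a_i\Sigma^{-1}$. Then $$\inf_{A\in\mathcal{S}}\sum_{i=0}^k\|\nabla_{A_i}f(A)\|_F^2=0,$$ where $\nabla_{A_i}f$ denotes the gradient of $f$ with respect to the matrix $A_i$ (with respect to the Frobenius inner product).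
   Context: $[X]_{i,j}$ denotes the $(i,j)$ entry of a matrix; $\|\cdot\|_F$ is the Frobenius norm. The expectation is over $x^{(1)},\dots,x^{(n+1)},w_\star$. *)

(* Defs.v *)
From HB Require Import structures.
From mathcomp Require Import all_boot all_order all_algebra.
From mathcomp Require Import all_classical all_reals all_analysis.
Set Implicit Arguments. Unset Strict Implicit. Unset Printing Implicit Defensive.
Import Order.TTheory GRing.Theory Num.Theory.
Import numFieldNormedType.Exports.
Local Open Scope classical_set_scope.
Local Open Scope ring_scope.

Section Defs.
Context {R : realType}.

Definition posdef (d : nat) (S : 'M[R]_d) : Prop :=
  S^T = S /\ forall v : 'cV[R]_d, v != 0 -> 0 < (v^T *m S *m v) 0 0.

(** Mutual independence of a finite family of real random variables:
    product rule for every family of Borel sets (this covers all subfamilies,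
    by taking the whole line for the omitted indices). *)
Definition mutually_independent d0 (T : measurableType d0) (P : probability T R)
  (I : finType) (X : I -> T -> R) : Prop :=
  forall B : I -> set R, (forall i, measurable (B i)) ->
    P (\bigcap_(i in [set: I]) (X i @^-1` B i)) = (\prod_(i : I) P (X i @^-1` B i))%E.

Definition std_normal d0 (T : measurableType d0) (P : probability T R)
  (X : T -> R) : Prop :=
  forall B : set R, measurable B -> P (X @^-1` B) = normal_prob 0 1 B.

Variables (d n k : nat).

(** The data matrix Z_0 in R^{(d+1) x (n+1)}: column c is (x^(c), y^(c)),
    except the last column, which is (x^(n+1), 0).  Here x c (c : 'I_(n+1))
    is x^(c+1) and y c = <x c, w>. *)
Definition Z0 (x : 'I_n.+1 -> 'cV[R]_d) (w : 'cV[R]_d) : 'M[R]_(d.+1, n.+1) :=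
  \matrix_(r < d.+1, c < n.+1)
    match unlift ord_max r with
    | Some r' => x c r' 0
    | None => if c == ord_max then 0 else (w^T *m x c) 0 0
    end.

Definition Mmask : 'M[R]_n.+1 :=
  \matrix_(r, c) if (r == c) && (r != ord_max) then 1 else 0.

Definition Pmat : 'M[R]_d.+1 :=
  \matrix_(r, c) if (r == ord_max) && (c == ord_max) then 1 else 0.

Definition Qmat (A : 'M[R]_d) : 'M[R]_d.+1 :=
  \matrix_(r, c)
    match unlift ord_max r, unlift ord_max c with
    | Some r', Some c' => A r' c'
    | _, _ => 0
    end.

Definition layer (A : 'M[R]_d) (Z : 'M[R]_(d.+1, n.+1)) : 'M[R]_(d.+1, n.+1) :=
  Z + (n%:R)^-1 *: (Pmat *m Z *m Mmask *m (Z^T *m Qmat A *m Z)).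

Fixpoint Zit (A : 'I_k.+1 -> 'M[R]_d) (Z : 'M[R]_(d.+1, n.+1)) (i : nat)
  : 'M[R]_(d.+1, n.+1) :=
  match i with
  | 0 => Z
  | i'.+1 => layer (A (inord i')) (Zit A Z i')
  end.

(** The random objects, built from i.i.d. standard normal scalars g:
    x^(c) = S g_c  (so x^(c) ~ N(0, S S^T) = N(0, Sigma)), and
    w_* = S^{-T} g_w (so w_* ~ N(0, (S S^T)^{-1}) = N(0, Sigma^{-1})). *)
Definition xvec d0 (T : measurableType d0) (S : 'M[R]_d)
  (g : option 'I_n.+1 * 'I_d -> T -> R) (t : T) (c : 'I_n.+1) : 'cV[R]_d :=
  S *m \col_(j < d) g (Some c, j) t.

Definition wvec d0 (T : measurableType d0) (S : 'M[R]_d)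
  (g : option 'I_n.+1 * 'I_d -> T -> R) (t : T) : 'cV[R]_d :=
  (invmx S)^T *m \col_(j < d) g (None, j) t.

Definition fobj d0 (T : measurableType d0) (P : probability T R) (S : 'M[R]_d)
  (g : option 'I_n.+1 * 'I_d -> T -> R) (A : 'I_k.+1 -> 'M[R]_d) : R :=
  fine (\int[P]_t
    (((Zit A (Z0 (xvec S g t) (wvec S g t)) k.+1) ord_max ord_max
      + (((wvec S g t)^T *m xvec S g t ord_max) 0 0)) ^+ 2)%:E)%E.

Definition perturb (A : 'I_k.+1 -> 'M[R]_d) (i : 'I_k.+1) (j l : 'I_d) (t : R)
  : 'I_k.+1 -> 'M[R]_d :=
  fun i' => if i' == i then A i' + t *: delta_mx j l else A i'.

Definition grad_sqnorm d0 (T : measurableType d0) (P : probability T R)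
  (S : 'M[R]_d) (g : option 'I_n.+1 * 'I_d -> T -> R) (A : 'I_k.+1 -> 'M[R]_d) : R :=
  \sum_(i < k.+1) \sum_(j < d) \sum_(l < d)
     (derive1 (fun t => fobj P S g (perturb A i j l t)) 0) ^+ 2.

End Defs.

(* Main.v *)
Require Import Defs.
From HB Require Import structures.
From mathcomp Require Import all_boot all_order all_algebra.
From mathcomp Require Import all_classical all_reals all_analysis.
From mathcomp Require Import fingroup perm measurable_realfun.
From mathcomp Require Import ring lra.
Import Order.TTheory GRing.Theory Num.Theory.
Import numFieldNormedType.Exports.
Local Open Scope classical_set_scope.
Local Open Scope ring_scope.

(**
  For [U] orthogonal and [V = S U S^-1], replacing every Gaussian vector [g_c]
  by [U g_c] turns the objective [f(A)] into [f(V^T A V)].  The law of the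
  Gaussian family is invariant under signed permutation matrices [U], so
  [f(A) = f(V^T A V)] for those [U]; this already forces the gradient of [f]
  with respect to [A_i], at a point of the set where each [A_i] is a multiple
  of [Sigma^-1], to be a multiple [c_i Sigma] of [Sigma].  Pairing it with
  [Sigma^-1] gives [d c_i = d_i h(a)], where [h(a) = f((a_i Sigma^-1)_i)].
  Since [h] is nonnegative and smooth, minimising [h + eps |a|^2] produces
  points where all partial derivatives of [h] are arbitrarily small.

  Smoothness and measurability of [f] are obtained by viewing the output of the
  network as a polynomial expression: any algebra of functions containing the
  entries of the inputs contains the output.
*)

Set Implicit Arguments.
Unset Strict Implicit.
Unset Printing Implicit Defensive.

(** * Algebras of functions and the network output *)

(** Scaling and finite sums follow from the three clauses. The instances below are the measurable,
    differentiable, finite-moment and separable functions. *)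
Definition subalgebra (R : realType) (Om : Type) (K : (Om -> R) -> Prop) : Prop :=
  [/\ forall c, K (fun=> c),
      forall f g, K f -> K g -> K (fun o => f o + g o) &
      forall f g, K f -> K g -> K (fun o => f o * g o)].

(** The prediction error as a deterministic function of the Gaussian coordinates [v], so that the
    Gaussian family can be exchanged for another one without reopening the network. *)
Definition residual (R : realType) (d n k : nat) (S : 'M[R]_d)
    (A : 'I_k.+1 -> 'M[R]_d) (v : option 'I_n.+1 * 'I_d -> R) : R :=
  let x c := S *m \col_(j < d) v (Some c, j) in
  let w := (invmx S)^T *m \col_(j < d) v (None, j) in
  Zit A (Z0 x w) k.+1 ord_max ord_max + (w^T *m x ord_max) 0 0.

Lemma fobjE (R : realType) (d n k : nat) d0 (T : measurableType d0)
    (P : probability T R) (S : 'M[R]_d) (g : option 'I_n.+1 * 'I_d -> T -> R)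
    (A : 'I_k.+1 -> 'M[R]_d) :
  fobj P S g A = fine (\int[P]_t ((residual S A (g^~ t)) ^+ 2)%:E)%E.
Proof. by []. Qed.

Section SubalgebraEntries.
Context (R : realType) (Om : Type) (K : (Om -> R) -> Prop).
Hypothesis hK : subalgebra K.

Let K_cst c : K (fun=> c). Proof. by case: hK. Qed.
Let K_add f g : K f -> K g -> K (fun o => f o + g o).
Proof. by case: hK => _ + _; apply. Qed.
Let K_mul f g : K f -> K g -> K (fun o => f o * g o).
Proof. by case: hK => _ _; apply. Qed.

Lemma subalgebra_sum (I : Type) (s : seq I) (F : I -> Om -> R) :
  (forall i, K (F i)) -> K (fun o => \sum_(i <- s) F i o).
Proof.
move=> KF; elim: s => [|i s ih].
  by rewrite (_ : (fun _ => _) = fun=> 0)//; apply/funext => o; rewrite big_nil.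
rewrite (_ : (fun _ => _) = fun o => F i o + \sum_(i <- s) F i o); first exact: K_add.
by apply/funext => o; rewrite big_cons.
Qed.

Definition mx_entries m n (M : Om -> 'M[R]_(m, n)) := forall i j, K (fun o => M o i j).

Lemma mx_entries_cst m n (M : 'M[R]_(m, n)) : mx_entries (fun=> M).
Proof. by move=> i j; exact: K_cst. Qed.

Lemma mx_entriesD m n (M N : Om -> 'M[R]_(m, n)) :
  mx_entries M -> mx_entries N -> mx_entries (fun o => M o + N o).
Proof.
move=> KM KN i j; rewrite (_ : (fun _ => _) = fun o => M o i j + N o i j).
  exact: K_add.
by apply/funext => o; rewrite mxE.
Qed.

Lemma mx_entriesZ m n (c : R) (M : Om -> 'M[R]_(m, n)) :
  mx_entries M -> mx_entries (fun o => c *: M o).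
Proof.
move=> KM i j; rewrite (_ : (fun _ => _) = fun o => c * M o i j).
  exact: K_mul.
by apply/funext => o; rewrite mxE.
Qed.

Lemma mx_entriesM m n p (M : Om -> 'M[R]_(m, n)) (N : Om -> 'M[R]_(n, p)) :
  mx_entries M -> mx_entries N -> mx_entries (fun o => M o *m N o).
Proof.
move=> KM KN i j; rewrite (_ : (fun _ => _) = fun o => \sum_l M o i l * N o l j).
  by apply: subalgebra_sum => l; exact: K_mul.
by apply/funext => o; rewrite mxE.
Qed.

Lemma mx_entries_tr m n (M : Om -> 'M[R]_(m, n)) :
  mx_entries M -> mx_entries (fun o => (M o)^T).
Proof.
move=> KM i j; rewrite (_ : (fun _ => _) = fun o => M o j i)//.
by apply/funext => o; rewrite mxE.
Qed.

Lemma mx_entries_Z0 d n (x : Om -> 'I_n.+1 -> 'cV[R]_d) (w : Om -> 'cV[R]_d) :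
  (forall c, mx_entries (x^~ c)) -> mx_entries w ->
  mx_entries (fun o => Z0 (x o) (w o)).
Proof.
move=> Kx Kw r c; rewrite (_ : (fun _ => _) = fun o =>
    match unlift ord_max r with
    | Some r' => x o c r' 0
    | None => if c == ord_max then 0 else ((w o)^T *m x o c) 0 0
    end); last by apply/funext => o; rewrite mxE.
case: (unlift ord_max r) => [r'|]; first by apply: (Kx c).
case: (c == ord_max); first exact: K_cst.
by apply: mx_entriesM; [exact: mx_entries_tr|exact: Kx].
Qed.

Lemma mx_entries_Qmat d (A : Om -> 'M[R]_d) :
  mx_entries A -> mx_entries (fun o => Qmat (A o)).
Proof.
move=> KA r c; rewrite (_ : (fun _ => _) = fun o =>
    match unlift ord_max r, unlift ord_max c with
    | Some r', Some c' => A o r' c'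
    | _, _ => 0
    end); last by apply/funext => o; rewrite mxE.
case: (unlift ord_max r) => [r'|]; last exact: K_cst.
by case: (unlift ord_max c) => [c'|]; [exact: KA|exact: K_cst].
Qed.

Lemma mx_entries_Zit d n k (A : Om -> 'I_k.+1 -> 'M[R]_d)
    (Z : Om -> 'M[R]_(d.+1, n.+1)) i :
  (forall l, mx_entries (A^~ l)) -> mx_entries Z ->
  mx_entries (fun o => Zit (A o) (Z o) i).
Proof.
move=> KA KZ; elim: i => [//|i ih] /=; rewrite /layer.
apply: mx_entriesD => //; apply: mx_entriesZ; apply: mx_entriesM.
  apply: mx_entriesM; last exact: mx_entries_cst.
  by apply: mx_entriesM => //; exact: mx_entries_cst.
apply: mx_entriesM => //; apply: mx_entriesM; first exact: mx_entries_tr.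
exact/mx_entries_Qmat.
Qed.

Lemma subalgebra_residual d n k (S : 'M[R]_d) (A : Om -> 'I_k.+1 -> 'M[R]_d)
    (v : Om -> option 'I_n.+1 * 'I_d -> R) :
  (forall i, mx_entries (A^~ i)) -> (forall i, K (v^~ i)) ->
  K (fun o => residual S (A o) (v o)).
Proof.
move=> KA Kv.
have Kcol c : mx_entries (fun o => \col_(j < d) v o (c, j)).
  move=> j z; rewrite (_ : (fun _ => _) = v^~ (c, j))//.
  by apply/funext => o; rewrite mxE.
have Kx c : mx_entries (fun o => S *m \col_(j < d) v o (Some c, j)).
  by apply: mx_entriesM => //; exact: mx_entries_cst.
have Kw : mx_entries (fun o => (invmx S)^T *m \col_(j < d) v o (None, j)).
  by apply: mx_entriesM => //; exact: mx_entries_cst.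
apply: K_add; first by apply: mx_entries_Zit => //; exact: mx_entries_Z0.
by apply: mx_entriesM => //; exact: mx_entries_tr.
Qed.

End SubalgebraEntries.

(* The expectation of such a function over the second variable integrates out
   the [X i] and leaves a combination of the [c i]. *)
Definition separable (R : realType) (U T : Type) (C : (U -> R) -> Prop)
    (W : (T -> R) -> Prop) (phi : U * T -> R) : Prop :=
  exists (I : finType) (c : I -> U -> R) (X : I -> T -> R),
    [/\ forall i, C (c i), forall i, W (X i) &
        forall o, phi o = \sum_i c i o.1 * X i o.2].

(** The disjoint union of the index types serves for sums, their cartesian product for products. *)
Lemma subalgebra_separable (R : realType) (U T : Type) (C : (U -> R) -> Prop)
    (W : (T -> R) -> Prop) :
  subalgebra C -> subalgebra W -> subalgebra (separable C W).
Proof.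
move=> [C1 _ CM] [W1 _ WM]; split.
- move=> c; exists unit, (fun=> fun=> c), (fun=> fun=> 1); split => // o.
  by rewrite big_const card_unit /= mulr1 addr0.
- move=> f g [I [c [X [Cc WX fE]]]] [J [b [Y [Cb WY gE]]]].
  exists (I + J)%type, (fun s => match s with inl i => c i | inr j => b j end),
    (fun s => match s with inl i => X i | inr j => Y j end).
  split => [[]//|[]//|o]; by rewrite fE gE big_sumType.
- move=> f g [I [c [X [Cc WX fE]]]] [J [b [Y [Cb WY gE]]]].
  exists (I * J)%type, (fun s u => c s.1 u * b s.2 u), (fun s t => X s.1 t * Y s.2 t).
  split => [s|s|o]; [exact: CM|exact: WM|].
  rewrite fE gE big_distrlr /= pair_big; apply: eq_bigr => s _ /=.
  by rewrite mulrACA.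
Qed.

Lemma separable_fst (R : realType) (U T : Type) (C : (U -> R) -> Prop)
    (W : (T -> R) -> Prop) (c : U -> R) :
  subalgebra W -> C c -> separable C W (fun o => c o.1).
Proof.
move=> [W1 _ _] Cc; exists unit, (fun=> c), (fun=> fun=> 1); split => // o.
by rewrite big_const card_unit /= mulr1 addr0.
Qed.

Lemma separable_snd (R : realType) (U T : Type) (C : (U -> R) -> Prop)
    (W : (T -> R) -> Prop) (X : T -> R) :
  subalgebra C -> W X -> separable C W (fun o => X o.2).
Proof.
move=> [C1 _ _] WX; exists unit, (fun=> fun=> 1), (fun=> X); split => // o.
by rewrite big_const card_unit /= mul1r addr0.
Qed.

(** * Random variables with finite absolute moments of every order *)

Section FiniteMoments.
Context (R : realType) d0 (T : measurableType d0) (P : probability T R).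

(** All orders are demanded at once because integrability alone is not stable under products. *)
Definition finite_moments (X : T -> R) : Prop :=
  measurable_fun [set: T] X /\
  forall p, P.-integrable [set: T] (fun t => (`|X t| ^+ p)%:E).

Lemma finite_moments_integrable X :
  finite_moments X -> P.-integrable [set: T] (EFin \o X).
Proof.
move=> [mX /(_ 1%N)]; apply: le_integrable => //; first exact/measurable_EFinP.
by move=> t _; rewrite /= expr1 lee_fin normr_id.
Qed.

(** The dominating functions are [2^p (|f|^p + |g|^p)] for [|f + g|^p], and [|f|^(2p) + |g|^(2p)]
    for [|f g|^p]. *)
Lemma subalgebra_finite_moments : subalgebra finite_moments.
Proof.
split.
- move=> c; split; first exact: measurable_cst.
  by move=> p; exact: finite_measure_integrable_cst.
- move=> f g [mf If] [mg Ig]; split; first exact: measurable_funD.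
  move=> p; have := integrableZl measurableT (2 ^+ p) (integrableD measurableT (If p) (Ig p)).
  apply: le_integrable => //.
    by apply/measurable_EFinP/measurable_funX/measurableT_comp => //;
      exact: measurable_funD.
  move=> t _ /=; rewrite lee_fin.
  rewrite (ger0_norm (exprn_ge0 p (normr_ge0 _))).
  rewrite [leRHS]ger0_norm ?mulr_ge0 ?addr_ge0 ?exprn_ge0//.
  set a := `|f t|; set b := `|g t|.
  have [a0 b0] : 0 <= a /\ 0 <= b by split; exact: normr_ge0.
  apply: (@le_trans _ _ ((a + b) ^+ p)).
    by rewrite lerXn2r// ?nnegrE ?addr_ge0//; exact: ler_normD.
  apply: (@le_trans _ _ ((2 * Num.max a b) ^+ p)).
    rewrite lerXn2r// ?nnegrE ?addr_ge0 ?mulr_ge0 ?le_max ?a0//.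
    by case: (leP a b); lra.
  rewrite exprMn ler_pM2l ?exprn_gt0//.
  by case: (leP a b) => _; rewrite ?lerDr ?lerDl exprn_ge0.
- move=> f g [mf If] [mg Ig]; split; first exact: measurable_funM.
  move=> p; have := integrableD measurableT (If (p + p)%N) (Ig (p + p)%N).
  apply: le_integrable => //.
    by apply/measurable_EFinP/measurable_funX/measurableT_comp => //;
      exact: measurable_funM.
  move=> t _ /=; rewrite lee_fin.
  rewrite (ger0_norm (exprn_ge0 p (normr_ge0 _))).
  rewrite [leRHS]ger0_norm ?addr_ge0 ?exprn_ge0//.
  rewrite normrM exprMn !exprD.
  set a := `|f t| ^+ p; set b := `|g t| ^+ p; nra.
Qed.

Lemma separable_expectation (U : Type) (C : (U -> R) -> Prop) (phi : U * T -> R) :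
  subalgebra C -> separable C finite_moments phi ->
  C (fun u => fine (\int[P]_t (phi (u, t))%:E)%E).
Proof.
move=> hC [I [c [X [Cc WX phiE]]]].
rewrite (_ : (fun _ => _) =
    fun u => \sum_i c i u * fine (\int[P]_t (X i t)%:E)%E).
  apply: subalgebra_sum => // i.
  by case: hC => C1 _ CM; exact: CM.
have IX i := finite_moments_integrable (WX i).
apply/funext => u; under eq_integral do rewrite phiE -sumEFin /=.
rewrite integral_sum//; last first.
  by move=> i; exact: (integrableZl measurableT (c i u) (IX i)).
rewrite -[RHS]/(fine (\sum_i c i u * fine (\int[P]_t (X i t)%:E)%E)%:E) -sumEFin.
congr fine; apply: eq_bigr => i _.
rewrite (EFinM (c i u)) fineK; last exact: integrable_fin_num (IX i).
by rewrite -(integralZl measurableT (IX i)).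
Qed.

End FiniteMoments.

(** * Moments and symmetry of the normal law *)

(** The density and the Radon-Nikodym derivative have the same integral over every measurable set,
    hence agree almost everywhere. *)
Lemma ge0_integral_normal_prob (R : realType) (m s : R) (f : R -> \bar R) :
  measurable_fun [set: R] f -> (forall x, 0 <= f x)%E ->
  (\int[normal_prob m s]_x f x
   = \int[lebesgue_measure]_x (f x * (normal_pdf m s x)%:E))%E.
Proof.
move=> mf f0.
have dom := normal_prob_dominates m s.
rewrite -(Radon_Nikodym_SigmaFinite.change_of_variables dom)//.
have mpdf : measurable_fun [set: R] (EFin \o normal_pdf m s).
  by apply/measurable_EFinP; exact: measurable_normal_pdf.
have iRN := Radon_Nikodym_SigmaFinite.f_integrable dom.
apply: ae_eq_integral => //.
- by apply: emeasurable_funM => //; exact: measurable_int iRN.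
- exact: emeasurable_funM.
- apply: ae_eqe_mul2l; apply: integral_ae_eq => //.
  by move=> A _ mA; rewrite -Radon_Nikodym_SigmaFinite.f_integral.
Qed.

(** Moments are controlled by a wider Gaussian: passing from deviation 1 to 2 gains the factor
    [expR (3 x^2 / 8)], which beats every power through [1 + y^m / m! <= expR y] with [m = p.+1]. *)
Lemma normr_exp_normal_fun_le (R : realType) (p : nat) (x : R) :
  `|x| ^+ p * normal_fun 0 1 x
  <= 3 ^+ p.+1 * (p.+1)`!%:R * normal_fun 0 2 x.
Proof.
set y := x ^+ 2 * 3 / 8.
have y0 : 0 <= y by rewrite divr_ge0// mulr_ge0// sqr_ge0.
have -> : normal_fun 0 2 x = expR y * normal_fun 0 1 x.
  by rewrite /normal_fun -expRD; congr expR; rewrite /y; field.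
rewrite mulrA ler_wpM2r ?normal_fun_ge0//.
have f1 : 1 <= (p.+1)`!%:R :> R by rewrite ler1n fact_gt0.
have f0 : 0 < (p.+1)`!%:R :> R by exact: lt_le_trans f1.
have t1 : 1 <= 3 ^+ p.+1 :> R by rewrite exprn_ege1// ler1n.
apply: (@le_trans _ _ (3 ^+ p.+1 * (p.+1)`!%:R * (1 + y ^+ p.+1 / (p.+1)`!%:R))); last first.
  by rewrite ler_wpM2l ?expR_ge1Dxn// mulr_ge0// ?(ltW f0)// exprn_ge0.
rewrite mulrDr mulr1 -mulrA (mulrC _ (y ^+ _ / _)) divfK ?gt_eqF// -exprMn.
(* For [|x| <= 1] the constant term suffices; otherwise [|x|^p] is at most [(x^2)^(p+1)], and
   [x^2 <= 3 y]. *)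
have [x1|x1] := leP `|x| 1.
  apply: (@le_trans _ _ 1); first by rewrite exprn_ile1.
  rewrite -[leLHS]addr0 lerD//; last by rewrite exprn_ge0// mulr_ge0.
  by rewrite (le_trans t1)// ler_peMr// (le_trans _ t1).
apply: (@le_trans _ _ (`|x| ^+ (2 * p.+1))).
  by rewrite ler_weXn2l// ?ltW// mul2n -addnn addSnnS leq_addr.
rewrite exprM real_normK ?num_real//.
apply: (@le_trans _ _ ((3 * y) ^+ p.+1)).
  have x2 : x ^+ 2 <= 3 * y by rewrite /y; move: (x ^+ 2) (sqr_ge0 x) => z; lra.
  by rewrite lerXn2r// nnegrE ?sqr_ge0// mulr_ge0.
by rewrite lerDr mulr_ge0// ?(ltW f0)// (le_trans _ t1).
Qed.

Lemma std_normal_finite_moments (R : realType) d0 (T : measurableType d0)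
    (P : probability T R) (X : T -> R) :
  measurable_fun [set: T] X -> std_normal P X -> finite_moments P X.
Proof.
move=> mX nX; split => // p.
have mp : measurable_fun [set: R] (fun x : R => (`|x| ^+ p)%:E).
  by apply/measurable_EFinP/measurable_funX; exact: normr_measurable.
apply/integrableP; split; first exact: measurableT_comp mp mX.
under eq_integral do rewrite gee0_abs ?lee_fin ?exprn_ge0//.
pose Y : T -> measurableTypeR R := X.
have mY : measurable_fun [set: T] Y by [].
rewrite -[ltLHS]/(\int[P]_(x in Y @^-1` [set: R])
  (((fun x : measurableTypeR R => (`|x| ^+ p)%:E) \o Y) x))%E.
rewrite -(ge0_integral_pushforward mY)//.
have -> : (\int[pushforward P Y]_y (`|y| ^+ p)%:E
    = \int[normal_prob 0 1]_y (`|y| ^+ p)%:E)%E.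
  by apply: eq_measure_integral => B mB _; exact: nX.
rewrite ge0_integral_normal_prob//.
(* The constant of the pointwise bound, corrected by the ratio of the normalising factors of the two
   densities. *)
pose C : R := normal_peak 1 * (3 ^+ p.+1 * (p.+1)`!%:R) / normal_peak 2.
have p1 := @normal_peak_gt0 R 1 (oner_neq0 _).
have p2 := @normal_peak_gt0 R 2 (lt0r_neq0 (ltr0Sn _ _)).
have mpdf (s : R) : measurable_fun [set: R] (fun x => (normal_pdf 0 s x)%:E).
  by apply/measurable_EFinP; exact: measurable_normal_pdf.
have C0 : 0 <= C.
  by rewrite /C divr_ge0 ?(ltW p2)// mulr_ge0 ?(ltW p1)// mulr_ge0 ?exprn_ge0// ler0n.
apply: (@le_lt_trans _ _ (\int[lebesgue_measure]_x (C%:E * (normal_pdf 0 2 x)%:E))%E).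
  apply: ge0_le_integral => //.
  - by move=> x _; rewrite -EFinM lee_fin mulr_ge0 ?exprn_ge0 ?normal_pdf_ge0.
  - exact: (emeasurable_funM mp (mpdf 1)).
  - exact: (emeasurable_funM (measurable_cst _) (mpdf 2)).
  - move=> x _; rewrite -!EFinM lee_fin !normal_pdfE ?oner_neq0 ?lt0r_neq0//.
    rewrite mulrCA [leRHS](_ : _ = normal_peak 1 *
      (3 ^+ p.+1 * (p.+1)`!%:R * normal_fun 0 2 x)).
      by rewrite ler_wpM2l ?(ltW p1)//; exact: normr_exp_normal_fun_le.
    rewrite /C; move: (normal_peak 2) p2 (3 ^+ _) => q q0 z.
    by field; rewrite gt_eqF.
rewrite integralZl//; last exact: integrable_normal_pdf.
by rewrite integral_normal_pdf mule1 ltry.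
Qed.

(** The density is even and Lebesgue measure is invariant under reflection. *)
Lemma normal_prob_oppr (R : realType) (B : set R) : measurable B ->
  normal_prob 0 1 ((-%R : R -> R) @^-1` B) = normal_prob 0 1 B.
Proof.
move=> mB; rewrite /normal_prob.
have pdfN (x : R) : normal_pdf 0 1 (- x) = normal_pdf 0 1 x.
  by rewrite !normal_pdfE ?oner_neq0// /normal_fun !subr0 sqrrN.
have mN : @measurable_fun _ _ (measurableTypeR R) (measurableTypeR R) setT -%R by [].
transitivity (\int[lebesgue_measure]_(x in (-%R : measurableTypeR R -> measurableTypeR R) @^-1` B)
    ((fun x => (normal_pdf 0 1 x)%:E) \o -%R) x)%E.
  by apply: eq_integral => x _ /=; rewrite pdfN.
rewrite -(@ge0_integral_pushforward _ _ _ _ _ _ mN lebesgue_measure B)//.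
- by apply: eq_measure_integral => A mA _; exact: lebesgue_measureN.
- by apply/measurable_EFinP/measurable_funTS; exact: measurable_normal_pdf.
- by move=> x _; rewrite lee_fin normal_pdf_ge0.
Qed.

(** * Invariance of the law of the Gaussian family *)

(** A generator of the product sigma-algebra on [I -> R]. The product rule of [mutually_independent]
    prescribes the joint law on exactly these sets. *)
Definition boxes (R : realType) (I : Type) : set (set (I -> R)) :=
  [set A | exists2 B : I -> set R, forall i, measurable (B i) &
           A = [set v | forall i, B i (v i)]].
Arguments boxes : clear implicits.

Lemma measurable_boxes_coord (R : realType) (I : Type) (i : I) :
  measurable_fun [set: g_sigma_algebraType (boxes R I)]
    (fun v : g_sigma_algebraType (boxes R I) => (v : I -> R) i).
Proof.
move=> _ B mB; rewrite setTI; apply: sub_sigma_algebra.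
exists (fun j => if `[< j = i >] then B else setT).
  by move=> j; case: ifP => // _; exact: measurableT.
apply/seteqP; split => v /= Bv; last by have := Bv i; case: asboolP.
by move=> j; case: asboolP => // ->.
Qed.

Lemma subalgebra_measurable (R : realType) d0 (T : measurableType d0) :
  subalgebra (fun f : T -> R => measurable_fun [set: T] f).
Proof.
split; first by move=> c; exact: measurable_cst.
- by move=> f g; exact: measurable_funD.
- by move=> f g; exact: measurable_funM.
Qed.

Section EqualLaws.
Context (R : realType) d0 (T : measurableType d0) (P : probability T R).
Context (I : finType).
Local Notation boxT := (g_sigma_algebraType (boxes R I)).

Let family (X : I -> T -> R) : T -> boxT := fun t i => X i t.

Let measurable_family (X : I -> T -> R) :
  (forall i, measurable_fun [set: T] (X i)) ->
  measurable_fun [set: T] (family X).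
Proof.
move=> mX; apply: (@measurability _ _ T boxT _ _ (boxes R I)) => // _ [_ [B mB ->] <-].
rewrite setTI (_ : _ @^-1` _ = \bigcap_(i in [set: I]) (X i @^-1` B i)).
  apply: fin_bigcap_measurable; first exact: finite_finset.
  by move=> i _; rewrite -[X in measurable X]setTI; exact: mX.
by apply/seteqP; split => t /= Bt; [move=> i _|move=> i]; exact: Bt.
Qed.

(** By independence and equal marginals the two joint laws agree on boxes. Boxes are stable under
    intersection, so the laws agree on the whole product sigma-algebra, and both integrals are
    integrals of [F] against that common law. *)
Lemma independent_integral_eq (X Y : I -> T -> R) (F : (I -> R) -> R) :
  (forall i, measurable_fun [set: T] (X i)) ->
  (forall i, measurable_fun [set: T] (Y i)) ->
  mutually_independent P X -> mutually_independent P Y ->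
  (forall i B, measurable B -> P (X i @^-1` B) = P (Y i @^-1` B)) ->
  measurable_fun [set: boxT] F -> (forall v, 0 <= F v) ->
  (\int[P]_t (F (X^~ t))%:E = \int[P]_t (F (Y^~ t))%:E)%E.
Proof.
move=> mX mY iX iY XY mF F0.
have mX' := measurable_family mX; have mY' := measurable_family mY.
have mFE : measurable_fun [set: boxT] (fun v : boxT => (F v)%:E).
  exact/measurable_EFinP.
transitivity (\int[pushforward P (family X)]_v (F v)%:E)%E.
  by rewrite ge0_integral_pushforward// => v _; rewrite lee_fin.
transitivity (\int[pushforward P (family Y)]_v (F v)%:E)%E; last first.
  by rewrite ge0_integral_pushforward// => v _; rewrite lee_fin.
have boxT_setT : boxes R I setT.
  by exists (fun=> setT) => //; apply/seteqP; split.
apply: eq_measure_integral => A mA _.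
apply: (@measure_unique _ _ boxT (boxes R I) (fun=> setT)) => //.
- move=> _ _ [B mB ->] [C mC ->]; exists (fun i => B i `&` C i).
    by move=> i; exact: measurableI.
  apply/seteqP; split => v /=; first by move=> [Bv Cv] i.
  by move=> BC; split => i; have [] := BC i.
- by rewrite bigcup_const.
- move=> _ [B mB ->]; rewrite /pushforward.
  have E (Z : I -> T -> R) : family Z @^-1` [set v | forall i, B i (v i)]
      = \bigcap_(i in [set: I]) (Z i @^-1` B i).
    by apply/seteqP; split => t /= Bt; [move=> i _|move=> i]; exact: Bt.
  transitivity (P (\bigcap_(i in [set: I]) (X i @^-1` B i))).
    by congr (P _); exact: E.
  transitivity (P (\bigcap_(i in [set: I]) (Y i @^-1` B i))); last first.
    by congr (P _); rewrite -E.
  by rewrite iX// iY//; apply: eq_bigr => i _; exact: XY.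
- by move=> _; rewrite [ltLHS](_ : _ = P [set: T])// probability_setT ltry.
Qed.

End EqualLaws.

Lemma std_normal_oppr (R : realType) d0 (T : measurableType d0)
    (P : probability T R) (X : T -> R) :
  std_normal P X -> std_normal P (fun t => - X t).
Proof.
move=> nX B mB; rewrite -normal_prob_oppr// -nX//.
by rewrite -[X in measurable X]setTI; exact: oppr_measurable.
Qed.

Lemma std_normal_sign (R : realType) d0 (T : measurableType d0)
    (P : probability T R) (X : T -> R) (b : bool) :
  std_normal P X -> std_normal P (fun t => (-1) ^+ b * X t).
Proof.
case: b => nX; last by under eq_fun do rewrite expr0 mul1r.
by under eq_fun do rewrite expr1 mulN1r; exact: std_normal_oppr.
Qed.

Lemma mutually_independent_signed_perm (R : realType) d0 (T : measurableType d0)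
    (P : probability T R) (I : finType) (X : I -> T -> R) (s : {perm I})
    (b : I -> bool) :
  mutually_independent P X ->
  mutually_independent P (fun i t => (-1) ^+ b i * X (s i) t).
Proof.
move=> iX B mB.
(* The sign is absorbed into the Borel set: [C i] is the constraint that [X i] inherits from the
   index which [s] sends to [i]. *)
pose C i : set R := ( *%R ((-1) ^+ b ((s^-1)%g i))) @^-1` B ((s^-1)%g i).
have mC i : measurable (C i).
  rewrite -[X in measurable X]setTI; apply: measurable_funM => //.
have EC i : (fun t => (-1) ^+ b i * X (s i) t) @^-1` B i = X (s i) @^-1` C (s i).
  by apply/seteqP; split => t; rewrite /C /= permK.
under eq_bigr do rewrite EC.
rewrite -(reindex_inj (@perm_inj _ s) (P := xpredT) (F := fun i => P (X i @^-1` C i))).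
rewrite -iX//; congr (P _); apply/seteqP; split => t h i _.
  by have := h ((s^-1)%g i) Logic.I; rewrite EC permKV.
by rewrite EC; exact: h.
Qed.

(** * Small partial derivatives *)

Lemma derive_line (R : realType) (V W : normedModType R) (f : V -> W) (a v : V) :
  'D_v f a = 'D_1 (fun s : R => f (a + s *: v)) 0.
Proof.
rewrite /derive; set F := (X in lim (X @ _) = _); set G := (X in _ = lim (X @ _)).
suff -> : F = G by []; apply/funext => s; rewrite /F /G /=.
by rewrite [s%:A]mulr1 addr0 scale0r addr0 [s *: v + a]addrC.
Qed.

Lemma differentiable_line (R : realType) (V W : normedModType R) (f : V -> W)
    (a v : V) (s : R) :
  differentiable f (a + s *: v) -> differentiable (fun s : R => f (a + s *: v)) s.
Proof.
move=> df; apply: (@differentiable_comp _ _ _ _ (fun s : R => a + s *: v) f) => //.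
Qed.

Lemma subalgebra_differentiable (R : realType) (V : normedModType R) :
  subalgebra (fun f : V -> R => forall x, differentiable f x).
Proof.
split; first by move=> c x; exact: differentiable_cst.
- by move=> f g df dg x; exact: differentiableD.
- by move=> f g df dg x; exact: differentiableM.
Qed.

(** At a minimiser [c] of [h + eps q] the partial derivative of [h] is [- 2 eps c_i], while
    [eps c_i^2 <= h 0]. Its square is therefore at most [4 eps h 0]. *)
Lemma small_partial_derivatives (R : realType) (m : nat) (h : 'rV[R]_m -> R) :
  (forall a, differentiable h a) -> (forall a, 0 <= h a) ->
  forall e : R, 0 < e -> exists a, forall i, `|'D_(delta_mx 0 i) h a| <= e.
Proof.
move=> dh h0 e e0.
(* Chosen so that [4 eps (h 0 + 1) = e^2]; the added 1 keeps the denominator positive when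
   [h 0 = 0]. *)
pose eps := e ^+ 2 / (4 * (h 0 + 1)).
have h01 : 0 < h 0 + 1 by rewrite ltr_wpDl.
have eps0 : 0 < eps by rewrite divr_gt0 ?exprn_gt0 ?mulr_gt0.
pose q (a : 'rV[R]_m) := \sum_j a 0 j ^+ 2.
have q0 a : 0 <= q a by apply: sumr_ge0 => j _; exact: sqr_ge0.
have coord_le_q (a : 'rV[R]_m) (i : 'I_m) : a 0 i ^+ 2 <= q a.
  by rewrite /q (bigD1 i)//= lerDl sumr_ge0// => j _; exact: sqr_ge0.
have dK := @subalgebra_differentiable R 'rV[R]_m.
have [dcst dadd dmul] := dK.
have dq : forall a, differentiable q a.
  apply: (subalgebra_sum dK) => j; apply: dmul => a; exact: differentiable_coord.
have deq : forall a, differentiable (fun a => eps * q a) a by exact: dmul.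
pose F a := h a + eps * q a.
have cF : continuous F.
  by move=> a; apply: differentiable_continuous; move: a; exact: dadd.
(* A compact set containing 0. Outside it [F a >= eps * q a > h 0 = F 0], so a minimiser on [A] is a
   global one. *)
pose A := [set a | eps * q a <= h 0].
have A0 : A 0.
  rewrite /A/= /q big1 ?mulr0// => j _; by rewrite mxE expr0n.
have bA : bounded_set A.
  (* With [t = h 0 / eps], a coordinate of absolute value above [t + 1 >= 1] would have a square
     above [t]. *)
  exists (h 0 / eps + 1); split; first by rewrite num_real.
  move=> M ltM a Aa; rewrite /Num.norm/= mx_normrE; apply/bigmax_leP; split.
    by rewrite (le_trans _ (ltW ltM))// addr_ge0// divr_ge0// ltW.
  move=> [i j] _ /=; rewrite (ord1 i).
  have : a 0 j ^+ 2 <= h 0 / eps.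
    by rewrite (le_trans (coord_le_q a j))// ler_pdivlMr// mulrC.
  have [//|Mx] := leP `|a 0 j| M.
  rewrite -real_normK ?num_real//; move: `|a 0 j| (normr_ge0 (a 0 j)) Mx => x x0 Mx xx.
  have t0 : 0 <= h 0 / eps by rewrite divr_ge0// ltW.
  by nra.
have clA : closed A.
  rewrite (_ : A = (fun a => eps * q a) @^-1` [set x | x <= h 0])//.
  apply: preimage_closed; last exact: closed_le.
  by move=> a _; exact: differentiable_continuous.
have [c /set_mem Ac minc] := EVT_min_rV (ex_intro _ _ A0)
  (bounded_closed_compact bA clA) (continuous_subspaceT cF).
have gmin a : F c <= F a.
  have [Aa|] := pselect (A a); first exact/minc/mem_set.
  move=> /negP; rewrite -ltNge => Aa.
  apply: (le_trans (minc 0 (mem_set A0))).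
  rewrite /F (_ : q 0 = 0) ?mulr0 ?addr0; last first.
    by rewrite /q big1// => j _; rewrite mxE expr0n.
  by rewrite ler_wpDl// ltW.
exists c => i; rewrite derive_line.
pose psi (s : R) := h (c + s *: delta_mx 0 i).
pose phi (s : R) := psi s + eps * (q c + 2 * c 0 i * s + s ^+ 2).
have FE s : phi s = F (c + s *: delta_mx 0 i).
  rewrite /phi /F /psi; congr (_ + _ * _); rewrite /q (bigD1 i)//= [RHS](bigD1 i)//=.
  rewrite !mxE !eqxx mulr1.
  under [in RHS]eq_bigr => j ji do rewrite !mxE (negbTE ji) andbF mulr0 addr0.
  by ring.
have dpsi (s : R) : derivable psi s 1.
  by apply/derivable1_diffP; exact/differentiable_line/dh.
have dphi (s : R) : is_derive s 1 phi ('D_1 psi s + eps * (2 * c 0 i + 2 * s)).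
  have ? : is_derive s 1 psi ('D_1 psi s) by exact/derivableP.
  apply: is_derive_eq; rewrite /GRing.scale /=; ring.
have : is_derive (0 : R) 1 phi 0.
  apply: (@derive1_at_min R phi (-1) 1 0).
  - by lra.
  - by move=> t _; exact: ex_derive.
  - by rewrite in_itv/=; lra.
  - by move=> t _; rewrite !FE scale0r addr0.
move=> /@derive_val; rewrite (@derive_val _ _ _ _ _ _ _ (dphi 0)) mulr0 addr0.
move=> /eqP; rewrite addr_eq0 => /eqP ->; rewrite normrN.
rewrite -(@ler_pXn2r _ 2)// ?nnegrE ?(ltW e0)// -normrX ger0_norm ?sqr_ge0//.
have Aci : eps * c 0 i ^+ 2 <= h 0.
  by rewrite (le_trans _ Ac)// ler_wpM2l ?(ltW eps0).
rewrite (_ : e ^+ 2 = eps * 4 * (h 0 + 1)); last by rewrite /eps; field; rewrite gt_eqF.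
rewrite (_ : _ ^+ 2 = eps * 4 * (eps * c 0 i ^+ 2)); last by ring.
apply: ler_wpM2l; first by rewrite mulr_ge0 ?(ltW eps0).
by apply: (le_trans Aci); rewrite lerDl.
Qed.

(** * Equivariance *)

Section Equivariance.
Context (R : realType) (d : nat).
Implicit Types (A V : 'M[R]_d).
Local Notation Pm := (@Pmat R d).

Lemma Qmat_tr A : (Qmat A)^T = Qmat A^T.
Proof.
apply/matrixP => i j; rewrite !mxE.
by case: (unlift ord_max i) => [?|]; case: (unlift ord_max j) => [?|]; rewrite ?mxE.
Qed.

Lemma Pmat_tr : Pm^T = Pm.
Proof. by apply/matrixP => i j; rewrite !mxE andbC. Qed.

Lemma Pmat_mulE m (Z : 'M[R]_(d.+1, m)) r c :
  (Pm *m Z) r c = if r == ord_max then Z ord_max c else 0.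
Proof.
rewrite mxE (bigD1_ord ord_max)//= mxE eqxx andbT big1 ?addr0.
  by case: ifP => _; rewrite ?mul1r ?mul0r.
by move=> i _; rewrite mxE (eq_sym (lift _ _)) (negbTE (neq_lift _ _)) andbF mul0r.
Qed.

Lemma Qmat_mul_lift m A (Z : 'M[R]_(d.+1, m)) r c :
  (Qmat A *m Z) (lift ord_max r) c = \sum_l A r l * Z (lift ord_max l) c.
Proof.
rewrite mxE (bigD1_ord ord_max)//= mxE liftK unlift_none mul0r add0r.
by apply: eq_bigr => l _; rewrite mxE !liftK.
Qed.

Lemma Qmat_mul_max m A (Z : 'M[R]_(d.+1, m)) c : (Qmat A *m Z) ord_max c = 0.
Proof. by rewrite mxE big1// => l _; rewrite mxE unlift_none mul0r. Qed.

Lemma Qmat_mul A V : Qmat A *m Qmat V = Qmat (A *m V).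
Proof.
apply/matrixP => i j; case: (unliftP ord_max i) => [i' ->|->].
  rewrite Qmat_mul_lift mxE liftK; case: (unliftP ord_max j) => [j' ->|->].
    by rewrite mxE; apply: eq_bigr => l _; rewrite mxE !liftK.
  by rewrite big1// => l _; rewrite mxE liftK unlift_none mulr0.
by rewrite Qmat_mul_max mxE unlift_none.
Qed.

Lemma Pmat_mul_Qmat A : Pm *m Qmat A = 0.
Proof.
by apply/matrixP => i j; rewrite Pmat_mulE !mxE unlift_none; case: ifP.
Qed.

Lemma Qmat_mul_Pmat A : Qmat A *m Pm = 0.
Proof. by apply: trmx_inj; rewrite trmx_mul Pmat_tr Qmat_tr Pmat_mul_Qmat trmx0. Qed.

Lemma Pmat_mul_Pmat : Pm *m Pm = Pm.
Proof.
by apply/matrixP => i j; rewrite Pmat_mulE !mxE eqxx; case: (i == ord_max).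
Qed.

(** The block-diagonal matrix [diag(V, 1)]: it changes basis in the [x] rows and keeps the [y]
    row. *)
Definition lift_mx V : 'M[R]_d.+1 := Qmat V + Pm.

Lemma lift_mx_mul_max m V (Z : 'M[R]_(d.+1, m)) c :
  (lift_mx V *m Z) ord_max c = Z ord_max c.
Proof. by rewrite mulmxDl mxE Qmat_mul_max add0r Pmat_mulE eqxx. Qed.

(** With [B = lift_mx V], [Pm] absorbs [B] on either side, and [B^T *m Qmat A *m B] is
    [Qmat (V^T *m A *m V)]. *)
Lemma layer_lift_mx n A V (Z : 'M[R]_(d.+1, n.+1)) :
  layer A (lift_mx V *m Z) = lift_mx V *m layer (V^T *m A *m V) Z.
Proof.
have PB : Pm *m lift_mx V = Pm.
  by rewrite mulmxDr Pmat_mul_Qmat add0r Pmat_mul_Pmat.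
have BP : lift_mx V *m Pm = Pm.
  by rewrite mulmxDl Qmat_mul_Pmat add0r Pmat_mul_Pmat.
have BQB : (lift_mx V)^T *m Qmat A *m lift_mx V = Qmat (V^T *m A *m V).
  rewrite /lift_mx [(_ + _)^T]linearD /= Pmat_tr Qmat_tr mulmxDl Pmat_mul_Qmat addr0 Qmat_mul.
  by rewrite mulmxDr Qmat_mul Qmat_mul_Pmat addr0.
rewrite /layer mulmxDr -scalemxAr; congr (_ + _ *: _).
by rewrite -BQB trmx_mul !mulmxA PB BP.
Qed.

Lemma Zit_lift_mx n k (A : 'I_k.+1 -> 'M[R]_d) V (Z : 'M[R]_(d.+1, n.+1)) i :
  Zit A (lift_mx V *m Z) i = lift_mx V *m Zit (fun l => V^T *m A l *m V) Z i.
Proof. by elim: i => //= i ->; exact: layer_lift_mx. Qed.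

Lemma Z0_lift_mx n V (x : 'I_n.+1 -> 'cV[R]_d) (w w' : 'cV[R]_d) :
  w'^T *m V = w^T -> Z0 (fun c => V *m x c) w' = lift_mx V *m Z0 x w.
Proof.
move=> ww'; apply/matrixP => r c; case: (unliftP ord_max r) => [r' ->|->].
  rewrite mulmxDl [RHS]mxE Qmat_mul_lift Pmat_mulE eq_sym.
  rewrite (negbTE (neq_lift _ _)) addr0 mxE liftK mxE.
  by apply: eq_bigr => l _; rewrite [in RHS]mxE liftK.
by rewrite lift_mx_mul_max [LHS]mxE [RHS]mxE unlift_none; case: ifP => // _; rewrite -ww' mulmxA.
Qed.

(** The inputs become [V x] and, [U] being orthogonal, the new weight satisfies [w'^T V = w^T]. All
    labels are thus preserved and [Z0] is multiplied by [lift_mx V], which does not alter the bottom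
    row where the output is read. *)
Lemma residual_equivariant n k (S U : 'M[R]_d) (A : 'I_k.+1 -> 'M[R]_d)
    (u v : option 'I_n.+1 * 'I_d -> R) :
  S \in unitmx -> U^T *m U = 1%:M ->
  (forall c, \col_(j < d) u (c, j) = U *m \col_(j < d) v (c, j)) ->
  let V := S *m U *m invmx S in
  residual S A u = residual S (fun i => V^T *m A i *m V) v.
Proof.
move=> Su UU uv V; rewrite /residual.
set w := (invmx S)^T *m \col_(j < d) v (None, j).
set w' := (invmx S)^T *m \col_(j < d) u (None, j).
pose x c := S *m \col_(j < d) v (Some c, j).
have xE : (fun c => S *m \col_(j < d) u (Some c, j)) = fun c => V *m x c.
  by apply/funext => c; rewrite uv /V /x !mulmxA mulmxKV.
have ww' : w'^T *m V = w^T.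
  rewrite /w /w' uv !trmx_mul !trmxK /V -!mulmxA; congr (_ *m _).
  by rewrite (mulmxA (invmx S)) mulVmx// mul1mx mulmxA UU mul1mx.
rewrite xE (Z0_lift_mx _ ww') Zit_lift_mx lift_mx_mul_max.
have -> : S *m \col_(j < d) u (Some ord_max, j) = V *m x ord_max :=
  congr1 (fun f => f ord_max) xE.
by rewrite mulmxA ww'.
Qed.

End Equivariance.

(** * Signed permutation matrices and their invariant linear forms *)

Definition signed_perm_mx (R : realType) (d : nat) (b : 'I_d -> bool)
  (s : {perm 'I_d}) : 'M[R]_d := \matrix_(i, j) ((-1) ^+ b i *+ (s i == j)).

Lemma signed_perm_mx_mul (R : realType) (d m : nat) (b : 'I_d -> bool)
    (s : {perm 'I_d}) (M : 'M[R]_(d, m)) i j :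
  (signed_perm_mx R b s *m M) i j = (-1) ^+ b i * M (s i) j.
Proof.
rewrite mxE (bigD1 (s i))//= mxE eqxx mulr1n big1 ?addr0// => l.
by rewrite eq_sym mxE => /negbTE ->; rewrite mulr0n mul0r.
Qed.

Lemma signed_perm_mx_orthogonal (R : realType) (d : nat) (b : 'I_d -> bool)
    (s : {perm 'I_d}) :
  (signed_perm_mx R b s)^T *m signed_perm_mx R b s = 1%:M.
Proof.
apply: mulmx1C; apply/matrixP => i j; rewrite signed_perm_mx_mul !mxE.
rewrite (inj_eq perm_inj) eq_sym; have [->|] := eqVneq i j.
  by rewrite !mulr1n -expr2 sqrr_sign.
by rewrite !mulr0n mulr0.
Qed.

Lemma signed_perm_mx_delta (R : realType) (d : nat) (b : 'I_d -> bool)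
    (s : {perm 'I_d}) (i j : 'I_d) :
  let U := signed_perm_mx R b s in
  U^T *m delta_mx i j *m U
  = ((-1) ^+ b i * (-1) ^+ b j) *: delta_mx (s i) (s j).
Proof.
move=> U; have rowU l : row l U = (-1) ^+ b l *: delta_mx 0 (s l).
  by apply/rowP => q; rewrite !mxE eqxx mulr_natr eq_sym.
rewrite -(mul_delta_mx (0 : 'I_1)) !mulmxA -mulmxA -rowE rowU.
rewrite -[delta_mx i 0]trmxK trmx_delta -trmx_mul -rowE rowU.
by rewrite [(_ *: _)^T]linearZ /= trmx_delta -scalemxAl -scalemxAr scalerA mul_delta_mx.
Qed.

(* Sign changes kill the off-diagonal coefficients, transpositions equate the
   diagonal ones. *)
Lemma signed_perm_invariant_trace (R : realType) (d : nat) (L : {linear 'M[R]_d -> R}) :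
  (forall b s B, L ((signed_perm_mx R b s)^T *m B *m signed_perm_mx R b s) = L B) ->
  exists c, forall B, L B = c * \tr B.
Proof.
case: d L => [|d] L inv.
  by exists 0 => B; rewrite mul0r (flatmx0 B) linear0.
have Ldelta (b : 'I_d.+1 -> bool) (s : {perm 'I_d.+1}) i j : L (delta_mx i j)
    = (-1) ^+ b i * (-1) ^+ b j * L (delta_mx (s i) (s j)).
  by rewrite -(inv b s) signed_perm_mx_delta linearZ.
exists (L (delta_mx ord0 ord0)) => B.
rewrite [in LHS](matrix_sum_delta B) linear_sum mulr_sumr; apply: eq_bigr => i _.
rewrite linear_sum (bigD1 i)//= big1 ?addr0 => [|j ji]; last first.
  rewrite linearZ /= [X in _ *: X](_ : _ = 0) ?scaler0//.
  (* Flipping the sign at [i] alone, with the identity permutation, makes this coefficient equal to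
     its opposite. *)
  have := Ldelta (pred1 i) 1%g i j; rewrite !perm1 /= eqxx (negbTE ji).
  by rewrite expr1 expr0 mulr1 mulN1r => /eqP; rewrite -addr_eq0 -mulr2n mulrn_eq0 => /eqP.
rewrite linearZ /= (Ldelta (fun=> false) (tperm i ord0)) tpermL.
by rewrite expr0 !mul1r mulrC.
Qed.

(** * The objective *)

Section Objective.
Context (R : realType) (d n k : nat) (d0 : measure_display) (T : measurableType d0).
Context (P : probability T R) (g : option 'I_n.+1 * 'I_d -> T -> R).
Hypothesis mg : forall i, measurable_fun [set: T] (g i).
Hypothesis indep_g : mutually_independent P g.
Hypothesis normal_g : forall i, std_normal P (g i).
Context (S : 'M[R]_d).
Implicit Types (A : 'I_k.+1 -> 'M[R]_d).

(** The squared residual is a finite sum of parameter factors in [C] times variables with finite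
    moments. Regularity in the parameter hence reaches the expectation without differentiating under
    the integral sign. *)
Lemma subalgebra_fobj (U : Type) (C : (U -> R) -> Prop) (A : U -> 'I_k.+1 -> 'M[R]_d) :
  subalgebra C -> (forall i j l, C (fun u => A u i j l)) ->
  C (fun u => fobj P S g (A u)).
Proof.
move=> hC CA; have hW := subalgebra_finite_moments P.
have hK := subalgebra_separable hC hW.
apply: (separable_expectation (phi := fun o => residual S (A o.1) (g^~ o.2) ^+ 2)) => //.
have Kres : separable C (finite_moments P) (fun o => residual S (A o.1) (g^~ o.2)).
  apply: (subalgebra_residual hK) => [i j l|i].
    exact: (separable_fst (c := fun u => A u i j l) hW).
  by apply: separable_snd => //; exact: std_normal_finite_moments.
by case: hK => _ _; apply.
Qed.

Lemma fobj_ge0 A : 0 <= fobj P S g A.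
Proof. by apply: fine_ge0; apply: integral_ge0 => t _; rewrite lee_fin sqr_ge0. Qed.

(** Each coordinate of the transformed Gaussian vector is a single original coordinate up to sign,
    so independence and marginals are inherited directly, without full rotation invariance. *)
Lemma fobj_signed_perm (b : 'I_d -> bool) (s : {perm 'I_d}) A : S \in unitmx ->
  let V := S *m signed_perm_mx R b s *m invmx S in
  fobj P S g (fun i => V^T *m A i *m V) = fobj P S g A.
Proof.
move=> Su V; rewrite fobjE [RHS]fobjE; apply: (congr1 fine).
(* The same permutation acts inside every vector, those of the inputs and that of the weight. *)
pose q (p : option 'I_n.+1 * 'I_d) := (p.1, s p.2).
have q_inj : injective q by move=> [c j] [c' j'] [-> /perm_inj ->].
pose Y p t := (-1) ^+ b p.2 * g (perm q_inj p) t.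
transitivity (\int[P]_t ((residual S A (Y^~ t)) ^+ 2)%:E)%E.
  apply: eq_integral => t _; congr (_ ^+ 2)%:E.
  rewrite (@residual_equivariant _ _ _ _ S (signed_perm_mx R b s) A _ (g^~ t))//.
    exact: signed_perm_mx_orthogonal.
  by move=> c; apply/colP => j; rewrite signed_perm_mx_mul !mxE /Y permE.
apply: (independent_integral_eq (X := Y) (Y := g) (F := fun v => residual S A v ^+ 2)) => //.
- by move=> p; apply: measurable_funM.
- exact: mutually_independent_signed_perm.
- by move=> p B mB; rewrite (normal_g p)//; exact: std_normal_sign.
- pose boxT := g_sigma_algebraType (boxes R (option 'I_n.+1 * 'I_d)%type).
  pose K := fun f : boxT -> R => measurable_fun [set: boxT] f.
  have hK : subalgebra K by exact: subalgebra_measurable.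
  have Kres : K (fun v => residual S A v).
    apply: (subalgebra_residual hK) => [i j l|p]; first by case: hK.
    exact: measurable_boxes_coord.
  by case: hK => _ _; apply.
- by move=> v; exact: sqr_ge0.
Qed.

(** Extends [perturb] from multiples of a matrix unit to an arbitrary increment, giving access to
    the full differential in [E]. *)
Definition add_at A (i : 'I_k.+1) (E : 'M[R]_d) : 'I_k.+1 -> 'M[R]_d :=
  fun i' => if i' == i then A i' + E else A i'.

Lemma differentiable_fobj_add_at A i E :
  differentiable (fun E => fobj P S g (add_at A i E)) E.
Proof.
move: E; apply: (subalgebra_fobj (subalgebra_differentiable _)) => i' j l E.
rewrite /add_at; case: (i' == i); last exact: differentiable_cst.
under eq_fun do rewrite mxE.
by apply: differentiableD; [exact: differentiable_cst|exact: differentiable_coord].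
Qed.

Lemma derivable_fobj_perturb A i j l :
  derivable (fun t => fobj P S g (perturb A i j l t)) 0 1.
Proof.
apply/derivable1_diffP.
rewrite (_ : (fun _ => _) = fun t => fobj P S g (add_at A i (0 + t *: delta_mx j l))).
  apply: (differentiable_line (f := fun E => fobj P S g (add_at A i E))).
  exact: differentiable_fobj_add_at.
by apply/funext => t; rewrite add0r.
Qed.

Lemma derive1_fobj_perturb A i j l :
  derive1 (fun t => fobj P S g (perturb A i j l t)) 0
  = 'D_(delta_mx j l) (fun E => fobj P S g (add_at A i E)) 0.
Proof.
set Phi := fun E => fobj P S g (add_at A i E).
rewrite (_ : (fun _ => _) = fun t => Phi (0 + t *: delta_mx j l)); last first.
  by apply/funext => t; rewrite add0r.
by rewrite derive1E -derive_line.
Qed.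

(** The base point is fixed by every congruence [V^T _ V], because [invmx Sigma] is
    [(invmx S)^T *m invmx S] and [U] is orthogonal. The differential there is consequently invariant
    under the same congruences. *)
Lemma derive_fobj_scaled_inv (a : 'I_k.+1 -> R) i : S \in unitmx ->
  let Sigma := S *m S^T in
  exists c, forall E,
    'D_E (fun E => fobj P S g (add_at (fun i => a i *: invmx Sigma) i E)) 0
    = c * \tr (E *m Sigma).
Proof.
move=> Su Sigma; set A := fun i => a i *: invmx Sigma.
have STu : S^T \in unitmx by rewrite unitmx_tr.
set Phi := fun E => fobj P S g (add_at A i E).
have dPhi : differentiable Phi 0 by exact: differentiable_fobj_add_at.
have SigmaV : invmx Sigma = (invmx S)^T *m invmx S.
  rewrite trmx_inv -[RHS]mul1mx -(mulVmx (_ : Sigma \in unitmx)); last first.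
    by rewrite unitmx_mul Su STu.
  by rewrite -!mulmxA (mulmxA S^T) mulmxV// mul1mx mulmxV// mulmx1.
pose V b s := S *m signed_perm_mx R b s *m invmx S.
have VE b s B : (V b s)^T *m ((invmx S)^T *m B *m invmx S) *m V b s
    = (invmx S)^T *m ((signed_perm_mx R b s)^T *m B *m signed_perm_mx R b s) *m invmx S.
  rewrite /V !trmx_mul !mulmxA; congr (_ *m _).
  by rewrite trmx_inv (mulmxK STu) (mulmxKV Su).
have VA b s i' : (V b s)^T *m A i' *m V b s = A i'.
  rewrite /A -scalemxAr -scalemxAl SigmaV; congr (_ *: _).
  by rewrite -[(invmx S)^T]mulmx1 VE !mulmx1 signed_perm_mx_orthogonal mulmx1.
have PhiV b s E : Phi ((V b s)^T *m E *m V b s) = Phi E.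
  have AE : add_at A i ((V b s)^T *m E *m V b s)
      = fun i' => (V b s)^T *m add_at A i E i' *m V b s.
    apply/funext => i'; rewrite /add_at; case: (i' == i); last by rewrite VA.
    by rewrite mulmxDr mulmxDl VA.
  by rewrite /Phi AE; exact: (fobj_signed_perm b s (add_at A i E) Su).
have DV b s E : 'D_((V b s)^T *m E *m V b s) Phi 0 = 'D_E Phi 0.
  rewrite (derive_line Phi) [RHS](derive_line Phi).
  set lhs := (X in derive X _ _ = _); set rhs := (X in _ = derive X _ _).
  suff -> : lhs = rhs by []; apply/funext => t; rewrite /lhs /rhs.
  by rewrite !add0r scalemxAl scalemxAr PhiV.
(* In the coordinate [B = S^T E S] the congruence by [V] becomes congruence by the signed
   permutation itself, and [\tr B = \tr (E *m Sigma)]. *)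
pose L B := 'd Phi 0 ((invmx S)^T *m B *m invmx S).
have linL : linear L.
  by move=> t B C; rewrite /L mulmxDr mulmxDl -scalemxAr -scalemxAl linearP.
pose linLM := GRing.isLinear.Build _ _ _ _ _ linL.
pose LL : {linear 'M[R]_d -> R} := HB.pack L linLM.
have [c cE] : exists c, forall B, LL B = c * \tr B.
  apply: signed_perm_invariant_trace => b s B.
  by rewrite /LL /= /L -VE -[LHS](deriveE _ dPhi) -[RHS](deriveE _ dPhi) DV.
exists c => E.
have -> : \tr (E *m Sigma) = \tr (S^T *m E *m S).
  by rewrite /Sigma mulmxA mxtrace_mulC mulmxA.
rewrite -cE /LL /= /L deriveE//; congr ('d Phi 0 _).
rewrite !mulmxA -trmx_mul mulmxV// trmx1 mul1mx.
by rewrite -mulmxA mulmxV// mulmx1.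
Qed.

End Objective.

(** * Invertibility of the covariance factor, and the infimum *)

Lemma posdef_unit (R : realType) (d : nat) (S : 'M[R]_d) :
  posdef (S *m S^T) -> S \in unitmx.
Proof.
move=> [_ pos]; rewrite -row_free_unit -kermx_eq0; apply: contraT => /rowV0Pn[v].
move=> /sub_kermxP vS v0; have vT0 : v^T != 0.
  by apply: contra v0 => /eqP v0; rewrite -[v]trmxK v0 trmx0.
by have := pos _ vT0; rewrite trmxK mulmxA vS !mul0mx mxE ltxx.
Qed.

Unset Implicit Arguments.
Set Strict Implicit.
Set Printing Implicit Defensive.

(** The first conjunct certifies that each [derive1] in [grad_sqnorm] is a true derivative, not the
    default value of a limit that fails to exist. *)
Theorem theorem3 (R : realType) (d n k : nat) (Sigma : 'M[R]_d)
  (hd : (0 < d)%N) (hn : (0 < n)%N) (hSigma : posdef Sigma)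
  (d0 : measure_display) (T : measurableType d0) (P : probability T R)
  (g : option 'I_n.+1 * 'I_d -> {RV P >-> R})
  (hind : mutually_independent P (fun i t => g i t))
  (hnorm : forall i, std_normal P (fun t => g i t))
  (S : 'M[R]_d) (hS : S *m S^T = Sigma) :
  let Sset := [set A : 'I_k.+1 -> 'M[R]_d |
                 exists a : 'I_k.+1 -> R, A = fun i => a i *: invmx Sigma] in
  (forall A, Sset A -> forall (i : 'I_k.+1) (j l : 'I_d),
     derivable (fun t => fobj P S (fun i t => g i t) (perturb A i j l t)) 0 1)
  /\ inf [set grad_sqnorm P S (fun i t => g i t) A | A in Sset] = 0.
Proof.
have mg i : measurable_fun [set: T] (fun t => g i t) by exact: measurable_funPT.
have Su : S \in unitmx by apply: posdef_unit; rewrite hS.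
have Sigmau : Sigma \in unitmx by rewrite -hS unitmx_mul unitmx_tr Su.
move=> Sset; split; first by move=> A _ i j l; exact: derivable_fobj_perturb.
set grads := [set _ | _ in _].
have grads_ge0 : lbound grads 0.
  move=> _ [A _ <-]; rewrite /grad_sqnorm.
  by do 3![apply: sumr_ge0 => ? _]; exact: sqr_ge0.
(* Rules out the default value of [inf] on the empty set, which would also be 0. *)
have grads_neq0 : grads !=set0.
  pose A0 : 'I_k.+1 -> 'M[R]_d := fun=> 0 *: invmx Sigma.
  by exists (grad_sqnorm P S (fun i t => g i t) A0), A0 => //; exists (fun=> 0).
apply/eqP; rewrite eq_le lb_le_inf// andbT; apply/ler_addgt0Pr => delta delta0.
rewrite add0r; pose N := \sum_j \sum_l Sigma l j ^+ 2.
have N0 : 0 <= N by do 2![apply: sumr_ge0 => ? _]; exact: sqr_ge0.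
pose M := k.+1%:R * (N + 1).
have M0 : 0 < M by rewrite mulr_gt0// ltr_wpDl.
(* The bound by 1 turns [|c| <= e] into [c^2 <= e]; the other makes the sum of the [k.+1] layer
   bounds [e * (N + 1)] at most [delta]. *)
pose e := Num.min 1 (delta / M).
have e0 : 0 < e by rewrite lt_min ltr01 divr_gt0.
have e1 : e <= 1 by rewrite ge_min lexx.
have eM : e * M <= delta by rewrite -ler_pdivlMr// ge_min lexx orbT.
pose h (a : 'rV[R]_k.+1) := fobj P S (fun i t => g i t) (fun i => a 0 i *: invmx Sigma).
have dh : forall a, differentiable h a.
  have dK := @subalgebra_differentiable R 'rV[R]_k.+1.
  apply: (subalgebra_fobj mg hnorm _ dK) => i j l.
  have [dcst _ dmul] := dK.
  rewrite (_ : (fun _ => _) = fun u : 'rV[R]_k.+1 => u 0 i * invmx Sigma j l).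
    by apply: dmul => a; [exact: differentiable_coord|exact: dcst].
  by apply/funext => u; rewrite mxE.
have [a aP] := small_partial_derivatives dh (fun a => fobj_ge0 _ _ _ _) e0.
pose A i := a 0 i *: invmx Sigma.
have SA : Sset A by exists (fun i => a 0 i).
apply: (@le_trans _ _ (grad_sqnorm P S (fun i t => g i t) A)).
  by apply: ge_inf; [exists 0|exists A].
have gradE i : exists2 c, c ^+ 2 <= e & forall j l,
    derive1 (fun t => fobj P S (fun i t => g i t) (perturb A i j l t)) 0 = c * Sigma l j.
  have [c cE] := derive_fobj_scaled_inv mg hind hnorm (fun i => a 0 i) i Su.
  rewrite hS in cE; exists c; last first.
    move=> j l; rewrite derive1_fobj_perturb cE; congr (_ * _).
    rewrite -(mul_delta_mx (0 : 'I_1)) -mulmxA mxtrace_mulC -rowE.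
    rewrite /mxtrace big_ord1 -colE /= !mxE //.
  (* Moving the scalar [a_i] is moving [A_i] along [invmx Sigma], and
     [\tr (invmx Sigma *m Sigma) = d]. As [d >= 1], a bound on this derivative bounds [c]. *)
  have dE : 'D_(delta_mx 0 i) h a = c * d%:R.
    rewrite -(mxtrace1 R d) -(mulVmx Sigmau) -cE (derive_line h) [RHS]derive_line.
    set lhs := (X in derive X _ _ = _); set rhs := (X in _ = derive X _ _).
    suff -> : lhs = rhs by []; apply/funext => t; rewrite /lhs /rhs /h.
    congr (fobj P S _ _); apply/funext => i'; rewrite /add_at add0r !mxE eqxx /=.
    by case: eqVneq => [->|_]; [rewrite mulr1 scalerDl|rewrite mulr0 addr0].
  have := aP i; rewrite dE.
  rewrite normrM (ger0_norm (ler0n _ _)) => cd.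
  have ce : `|c| <= e by rewrite (le_trans _ cd)// ler_peMr// ler1n.
  rewrite -real_normK ?num_real// expr2 -[leRHS]mulr1.
  by rewrite ler_pM// (le_trans ce).
rewrite /grad_sqnorm (le_trans _ eM)//.
apply: (@le_trans _ _ (\sum_(i < k.+1) e * (N + 1))); last first.
  by rewrite sumr_const card_ord /M mulr_natl mulrnAr.
apply: ler_sum => i _; have [c ce cE] := gradE i.
apply: (@le_trans _ _ (c ^+ 2 * N)).
  rewrite /N mulr_sumr; apply: ler_sum => j _; rewrite mulr_sumr.
  by apply: ler_sum => l _; rewrite cE exprMn.
by rewrite ler_pM ?sqr_ge0// lerDl.
Qed.
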